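(* Let $a<1$, $p\in(0,1)$, $\gamma_0>0$, $n\ge1$, and let $\boldsymbol z=(z_1,\ldots,z_n)\sim\mathrm{gCRSF}(n,\gamma_0,a,p)$. For $1\le i\le n$ the marginal distribution of $z_{1:i}=(z_1,\ldots,z_i)$ is $$p(z_{1:i}\mid n,\gamma_0,a,p)=p(z_{1:i}\mid i,\gamma_0,a,p)\,\frac{\sum_{\ell=0}^{i}\gamma_0^\ell p^{-a\ell}S_a(i,\ell)}{\sum_{\ell=0}^n\gamma_0^\ell p^{-a\ell}S_a(n,\ell)}\,R_{n,\gamma_0,a,p}(i,l_{(i)})$$ $$=\frac{R_{n,\gamma_0,a,p}(i,l_{(i)})\,\gamma_0^{l_{(i)}}p^{-al_{(i)}}}{\sum_{\ell=0}^n\gamma_0^\ell p^{-a\ell}S_a(n,\ell)}\prod_{k:\,n_{k,(i)}>0}\frac{\Gamma(n_{k,(i)}-a)}{\Gamma(1-a)},$$ where $l_{(i)}$ is the number of clusters in $z_{1:i}$, $n_{k,(i)}=\sum_{j=1}^i\mathbf 1(z_j=k)$, and $p(z_{1:i}\mid i,\gamma_0,a,p)$ denotes the $\mathrm{gCRSF}(i,\gamma_0,a,p)$ probability of $z_{1:i}$. Moreover, if $a=0$ then $p(z_{1:i}\mid n,\gamma_0,0,p)=p(z_{1:i}\mid i,\gamma_0,0,p)$ for all $i\le n$.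
   Context: The generalized Chinese restaurant sampling formula $\mathrm{gCRSF}(n,\gamma_0,a,p)$ is the probability distribution on partitions of $\{1,\ldots,n\}$, encoded by cluster labels $\boldsymbol z=(z_1,\ldots,z_n)$ in order of appearance (so $z_1=1$ and each new cluster gets the next unused label), given by $$p(\boldsymbol z\mid n,\gamma_0,a,p)=\frac{\gamma_0^{l}p^{-al}}{\sum_{\ell=0}^n\gamma_0^\ell p^{-a\ell}S_a(n,\ell)}\prod_{k=1}^{l}\frac{\Gamma(n_k-a)}{\Gamma(1-a)},$$ where $l$ is the number of clusters and $n_k$ the size of cluster $k$. Here $S_a(n,l)=\frac{n!}{l!}\sum_{*}\prod_{k=1}^l\frac{\Gamma(n_k-a)}{n_k!\,\Gamma(1-a)}$ for $1\le l\le n$, with $\sum_*$ over all $l$-tuples of positive integers summing to $n$, and $S_a(n,0)=0$ for $n\ge1$. $R_{n,\gamma_0,a,p}(i,j)$ is defined for $1\le j\le i\le n$ by $R_{n,\gamma_0,a,p}(n,j)=1$ and, for $i=n-1,n-2,\ldots,1$, $$R_{n,\gamma_0,a,p}(i,j)=R_{n,\gamma_0,a,p}(i+1,j)\,(i-aj)+R_{n,\gamma_0,a,p}(i+1,j+1)\,\gamma_0p^{-a}.$$ *)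

(* Defs.v *)
From HB Require Import structures.
From mathcomp Require Import all_boot all_order all_algebra.
From mathcomp Require Import all_classical all_reals all_analysis.

Set Implicit Arguments.
Unset Strict Implicit.
Unset Printing Implicit Defensive.

Import Order.TTheory GRing.Theory Num.Theory.
Import numFieldNormedType.Exports.

Local Open Scope classical_set_scope.
Local Open Scope ring_scope.

(* Euler's integral; it is meaningful for 0 < x, and only used there: all the
   arguments below are of the form m%:R - a with 1 <= m and a < 1. *)
Definition Gamma {R : realType} (x : R) : R :=
  \int[lebesgue_measure]_(t in `]0, +oo[) (t `^ (x - 1) * expR (- t)).

(* A partition of {1, ..., n} is encoded by the sequence of its labels, which
   start from 1: every item carries either a label already in use or the next
   unused one, (number of labels used so far) + 1. In particular z_1 = 1. *)
Definition appearance_order (z : seq nat) : bool :=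
  [forall j : 'I_(size z),
     (nth 0%N z j \in take j z) ||
     (nth 0%N z j == (size (undup (take j z))).+1)].

Definition num_clusters (z : seq nat) : nat := size (undup z).

Definition cluster_size (z : seq nat) (k : nat) : nat := count_mem k z.

Section GCRSF.
Context {R : realType}.
Implicit Types (gamma a p : R) (n l i j : nat).

(* Positive integers with sum n are at most n, so 'I_n.+1 loses no tuple. For
   l = 0 and 1 <= n the sum is empty, see gen_stirling_n0. *)
Definition gen_stirling a n l : R :=
  n`!%:R / l`!%:R *
  \sum_(m : {ffun 'I_l -> 'I_n.+1} |
          [forall k, (0 < m k)%N] && (\sum_(k < l) m k == n)%N)
     \prod_(k < l) (Gamma ((m k)%:R - a) / ((m k)`!%:R * Gamma (1 - a))).

Definition gCRSF_norm n gamma0 a p : R :=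
  \sum_(0 <= l < n.+1)
     gamma0 ^+ l * p `^ (- (a * l%:R)) * gen_stirling a n l.

(* Probability mass function on all label sequences of length n; it vanishes on
   those that do not encode a partition. *)
Definition gCRSF n gamma0 a p (z : n.-tuple nat) : R :=
  if appearance_order z then
    gamma0 ^+ num_clusters z * p `^ (- (a * (num_clusters z)%:R))
      / gCRSF_norm n gamma0 a p *
    \prod_(1 <= k < (num_clusters z).+1)
       (Gamma ((cluster_size z k)%:R - a) / Gamma (1 - a))
  else 0.

(* The backward recursion R_(n, gamma0, a, p)(i, j), run on d = n - i; its
   defining equations are gCRSF_R_last and gCRSF_R_rec. *)
Fixpoint gCRSF_R_aux n gamma0 a p (d j : nat) : R :=
  if d is d'.+1 then
    gCRSF_R_aux n gamma0 a p d' j * ((n - d)%:R - a * j%:R) +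
    gCRSF_R_aux n gamma0 a p d' j.+1 * (gamma0 * p `^ (- a))
  else 1.

Definition gCRSF_R n gamma0 a p i j : R := gCRSF_R_aux n gamma0 a p (n - i) j.

Lemma gen_stirling_n0 a n : (1 <= n)%N -> gen_stirling a n 0 = 0.
Proof.
move=> n1; rewrite /gen_stirling big_pred0 ?mulr0// => m.
by rewrite big_ord0 (ltn_eqF n1) andbF.
Qed.

Lemma gCRSF_R_last n gamma0 a p j : gCRSF_R n gamma0 a p n j = 1.
Proof. by rewrite /gCRSF_R subnn. Qed.

Lemma gCRSF_R_rec n gamma0 a p i j : (i < n)%N ->
  gCRSF_R n gamma0 a p i j =
  gCRSF_R n gamma0 a p i.+1 j * (i%:R - a * j%:R) +
  gCRSF_R n gamma0 a p i.+1 j.+1 * (gamma0 * p `^ (- a)).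
Proof.
by move=> ltin; rewrite /gCRSF_R -(subnSK ltin) /= subnSK// subKn// ltnW.
Qed.

End GCRSF.

Arguments gCRSF {R} n gamma0 a p z.

(* Main.v *)
(* Let W(z) = gamma0^l p^(-a l) prod_k Gamma(n_k - a) / Gamma(1 - a) be the
   unnormalised weight. By Gamma(x + 1) = x Gamma(x), appending an item to a
   cluster of size n_k multiplies W by n_k - a, and opening a new cluster
   multiplies it by gamma0 p^(-a). As the factors n_k - a of a prefix of length
   i with l clusters add up to i - a l, the recursion for R is exactly what
   summing the last label out does, whence P(z_{1:i} = w) = W(w) R(i, l) / N_n
   by downward induction on i, N_n being the normalising constant.
   For a = 0 the number R(i, j) does not depend on j, and it equals N_n / N_i
   because N_{n+1} = (n + gamma0) N_n. The latter follows from the equation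
   (1 - X) (L^l)' = l L^(l-1) for L = - ln (1 - X), the exponential generating
   series of the S_0(., l) being L^l / l!. *)

Require Import Defs.
From HB Require Import structures.
From mathcomp Require Import all_boot all_order all_algebra.
From mathcomp Require Import all_classical all_reals all_analysis.
From mathcomp Require Import measurable_realfun ring lra.

Set Implicit Arguments.
Unset Strict Implicit.
Unset Printing Implicit Defensive.

Import Order.TTheory GRing.Theory Num.Theory.
Import numFieldNormedType.Exports.

Local Open Scope classical_set_scope.
Local Open Scope ring_scope.

(** * Euler's integral: functional equation, integer values, finiteness, positivity *)

Section GammaFunction.
Context {R : realType}.
Notation mu := (@lebesgue_measure R).
Implicit Types (x t : R).

Let integrand x t : \bar R := (t `^ (x - 1) * expR (- t))%:E.

(** Kept in the extended reals, so that limits of integrals can be taken before finiteness is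
    known. *)
Let eGamma x : \bar R := (\int[mu]_(t in `]0%R, +oo[) integrand x t)%E.

Let GammaE x : Gamma x = fine (eGamma x). Proof. by []. Qed.

Let integrand_ge0 x t : (0 <= integrand x t)%E.
Proof. by rewrite lee_fin mulr_ge0 ?powR_ge0 ?expR_ge0. Qed.

Let measurable_integrand x (D : set R) :
  measurable D -> measurable_fun D (integrand x).
Proof.
move=> mD; apply: measurable_funTS; apply/measurable_EFinP.
apply: measurable_funM; first exact: measurable_powR.
by apply: measurableT_comp => //; exact: measurableT_comp.
Qed.

Let eGamma_ge0 x : (0 <= eGamma x)%E.
Proof. by apply: integral_ge0 => t _; exact: integrand_ge0. Qed.

(** Compact segments exhausting the open half-line and avoiding the singularity at 0. The shift by 2
    makes them nondegenerate already at [n = 0]. *)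
Let D n : set R := `[n.+2%:R^-1, n.+2%:R]%classic.

Let cvg_eGamma x :
  (\int[mu]_(t in D n) integrand x t)%E @[n --> \oo] --> eGamma x.
Proof.
have -> : eGamma x = (\int[mu]_(t in \bigcup_n D n) integrand x t)%E.
  rewrite /eGamma; congr (integral _ _ _).
  apply/seteqP; split => t /=.
    rewrite in_itv/= andbT => t0.
    (* The first bound puts [t] below the right end, the second puts it above the left end. *)
    exists (maxn (Num.bound t) (Num.bound t^-1)) => //=.
    rewrite /D/= in_itv/=; apply/andP; split.
      rewrite -[leRHS]invrK lef_pV2 ?posrE ?invr_gt0 ?ltr0n//.
      apply: (le_trans (ltW (archi_boundP _))); first by rewrite invr_ge0 ltW.
      by rewrite ler_nat !leqW// leq_maxr.
    apply: (le_trans (ltW (archi_boundP (ltW t0)))).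
    by rewrite ler_nat !leqW// leq_maxl.
  move=> [n _]; rewrite /D/= !in_itv/= andbT => /andP[nt _].
  by apply: lt_le_trans nt; rewrite invr_gt0 ltr0n.
apply: ge0_nondecreasing_set_cvg_integral.
- apply/nondecreasing_seqP => n; rewrite subsetEset /D => t /=.
  rewrite !in_itv/= => /andP[nt tn]; apply/andP; split.
    by apply: le_trans nt; rewrite lef_pV2 ?posrE ?ltr0n// ler_nat.
  by apply: (le_trans tn); rewrite ler_nat.
- by move=> n; exact: measurable_itv.
- by move=> n; apply: measurable_integrand; exact: measurable_itv.
- by move=> n t _; exact: integrand_ge0.
Qed.

(** The increment of [t ^ x * exp (- t)] over [D n]. *)
Let boundary x (n : nat) : R :=
  n.+2%:R `^ x * expR (- n.+2%:R) - n.+2%:R^-1 `^ x * expR (- n.+2%:R^-1).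

Let by_parts x n : (\int[mu]_(t in D n) integrand (x + 1) t =
  x%:E * \int[mu]_(t in D n) integrand x t - (boundary x n)%:E)%E.
Proof.
have ab : n.+2%:R^-1 < n.+2%:R :> R.
  apply: (@lt_le_trans _ _ 1); last by rewrite ler1n.
  by rewrite invf_lt1 ?ltr1n ?ltr0n.
have a0 : 0 < n.+2%:R^-1 :> R by rewrite invr_gt0 ltr0n.
have pos y : y \in `[n.+2%:R^-1, n.+2%:R] -> 0 < y :> R.
  by rewrite in_itv/= => /andP[+ _]; exact: lt_le_trans.
have poso y : y \in `]n.+2%:R^-1, n.+2%:R[ -> 0 < y :> R.
  by move=> yI; apply: pos; exact: subset_itv_oo_cc.
have powc z y : 0 < y -> {for y, continuous (@powR R ^~ z)}.
  move=> y0; apply/differentiable_continuous/derivable1_diffP.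
  by apply: derivable_powR; rewrite in_itv/= y0.
have expc : continuous (fun t : R => expR (- t)).
  by move=> t; apply: continuous_comp; [exact: continuousN | exact: continuous_expR].
have dexp (t : R) : (fun t : R => - expR (- t))^`()%classic t = expR (- t).
  rewrite derive1N; last exact: ex_derive.
  rewrite derive1_comp// derive1N// derive1_id mulrN1 opprK derive1E.
  by have /funeqP -> := @derive_expR R.
rewrite /integrand addrK.
have wpow z : {within `[n.+2%:R^-1, n.+2%:R], continuous (@powR R ^~ z)}.
  apply/continuous_in_subspaceT => y /[!inE]/= yI.
  exact/powc/pos.
rewrite (integration_by_parts (F := fun t => t `^ x) (G := fun t => - expR (- t))
  (f := fun t => x * t `^ (x - 1)) (g := fun t => expR (- t)) ab).
- under eq_integral => t _ do rewrite mulrN -mulrA -mulNr EFinM.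
  rewrite integralZl//; last first.
    apply: continuous_compact_integrable.
      exact: segment_compact.
    move=> t; apply: (@continuousM _ (subspace _) (fun t => t `^ (x - 1))
      (fun t => expR (- t))); first exact: wpow.
    exact: continuous_subspaceT.
  rewrite EFinN mulNe oppeK addeC; congr (_ + _)%E.
  by rewrite -EFinN /boundary; congr EFin; ring.
- move=> t; apply: (@continuousM _ (subspace _) (fun=> x)
    (fun t => t `^ (x - 1))); first exact: cst_continuous.
  exact: wpow.
- split.
  + by move=> y /poso y0; apply: derivable_powR; rewrite in_itv/= y0.
  + by apply/cvg_at_right_filter; apply: powc.
  + by apply/cvg_at_left_filter; apply: powc; rewrite ltr0n.
- by move=> y /poso y0; apply: powR_derive1; rewrite in_itv/= y0.
- exact: continuous_subspaceT.
- split.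
  + by move=> y _; exact: ex_derive.
  + by apply/cvg_at_right_filter; apply: cvgN; exact: expc.
  + by apply/cvg_at_left_filter; apply: cvgN; exact: expc.
- by move=> y _; exact: dexp.
Qed.

(** At the right end the exponential beats the power; at the left end the power tends to 0 because
    [0 < x], and the exponential is at most 1. *)
Let boundary_cvg0 x : 0 < x -> boundary x n @[n --> \oo] --> 0.
Proof.
move=> x0; rewrite -[X in _ --> X]subr0; apply: cvgB.
  (* For [t = n + 2], [t ^ x <= t ^ m] and [exp t >= t ^ (m + 1) / (m + 1)!], so the term is at most
     [(m + 1)! / t]. *)
  pose m := Num.bound x.
  apply: (@squeeze_cvgr _ _ _ _ (fun=> 0) (fun n => m.+1`!%:R * harmonic n)).
  - near=> n; rewrite mulr_ge0 ?powR_ge0 ?expR_ge0//=.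
    have n0 : 0 < n.+2%:R :> R by rewrite ltr0n.
    have xm : n.+2%:R `^ x <= n.+2%:R ^+ m :> R.
      rewrite -powR_mulrn; last exact: ltW.
      by apply: ler_powR; [rewrite ler1n | exact/ltW/archi_boundP/ltW].
    have f0 : 0 < m.+1`!%:R :> R by rewrite ltr0n fact_gt0.
    have expm : n.+2%:R ^+ m.+1 / m.+1`!%:R <= expR n.+2%:R :> R.
      by apply: le_trans (expR_ge1Dxn m (ltW n0)); rewrite lerDr.
    rewrite expRN; apply: (@le_trans _ _ (n.+2%:R ^+ m / (n.+2%:R ^+ m.+1 / m.+1`!%:R))).
      apply: ler_pM => //; rewrite ?powR_ge0 ?invr_ge0 ?expR_ge0//.
      by rewrite lef_pV2 ?posrE ?expR_gt0// divr_gt0 ?exprn_gt0.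
    rewrite exprS invf_div mulrCA mulrA.
    rewrite -[leRHS]/(m.+1`!%:R * n.+1%:R^-1) -mulrA; apply: ler_wpM2l; first exact: ltW.
    rewrite invfM mulrCA mulfV ?mulr1; last by rewrite expf_neq0// gt_eqF.
    by rewrite lef_pV2 ?posrE ?ltr0n// ler_nat.
  - exact: cvg_cst.
  - by rewrite -[X in _ --> X](mulr0 m.+1`!%:R); apply: cvgMr; exact: cvg_harmonic.
have cvgV : n.+2%:R^-1 `^ x @[n --> \oo] --> (0 : R).
  apply: ((cvg_at_rightP _ _ _).1 (powR_cvg0 x0)); split.
    by move=> n; rewrite invr_gt0 ltr0n.
  by have := @cvg_harmonic R; rewrite -cvg_shiftS.
apply: (@squeeze_cvgr _ _ _ _ (fun=> 0) _ _ _ _ _ cvgV); last exact: cvg_cst.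
near=> n; rewrite mulr_ge0 ?powR_ge0 ?expR_ge0//=.
by rewrite ler_piMr ?powR_ge0// -expR0 ler_expR lerNl oppr0 invr_ge0.
Unshelve. all: end_near. Qed.

(** Limit of [by_parts] along the segments. The identity is between extended reals because
    finiteness is later derived from it; the sum of limits is well defined since the boundary term
    is finite. *)
Let eGammaS x : 0 < x -> (eGamma (x + 1) = x%:E * eGamma x)%E.
Proof.
move=> x0; rewrite -(cvg_lim _ (@cvg_eGamma (x + 1)))//; apply: cvg_lim => //.
have -> : (fun n => \int[mu]_(t in D n) integrand (x + 1) t)%E =
    (fun n => x%:E * \int[mu]_(t in D n) integrand x t + - (boundary x n)%:E)%E.
  by apply/funext => n; rewrite by_parts.
rewrite -[X in _ --> X]adde0; apply: cvgeD.
- by rewrite fin_num_adde_defl.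
- by apply: cvgeZl => //; exact: cvg_eGamma.
- rewrite -oppe0; apply: cvgeN; apply/fine_cvgP; split; first exact: nearW.
  exact: boundary_cvg0.
Qed.

(** The integrand is the exponential density of rate 1, of total mass 1. *)
Let eGamma1 : eGamma 1 = 1%E.
Proof.
rewrite -(@integral_exponential_pdf R 1)// /eGamma integral_itv_obnd_cbnd; last first.
  exact: measurable_integrand.
rewrite [LHS]integral_mkcond; apply: eq_integral => t _.
rewrite /exponential_pdf !patchE; case: ifP => // _.
by rewrite /integrand subrr powRr0 !mul1r mulN1r.
Qed.

Let eGamma_nat n : eGamma n.+1%:R = (n`!%:R)%:E.
Proof.
elim: n => [|n IH]; first by rewrite eGamma1.
by rewrite -[n.+2]addn1 natrD eGammaS// IH -EFinM -natrM -factS.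
Qed.

(* For y >= 1 the bound t^(y-1) <= 1 + t^m reduces finiteness to integer
   arguments; below 1 it comes from the functional equation. *)
Let eGamma_fin x : 0 < x -> eGamma x \is a fin_num.
Proof.
have ge1 (y : R) : 1 <= y -> (eGamma y < +oo)%E.
  move=> y1; set m := Num.bound y.
  have ym : y - 1 <= m%:R.
    have y0 : 0 <= y by exact: le_trans y1.
    by apply: le_trans (ltW (archi_boundP y0)); rewrite gerBl.
  have mI z : measurable_fun (`]0, +oo[%classic : set R) (integrand z).
    exact: measurable_integrand.
  apply: (@le_lt_trans _ _ (eGamma 1 + eGamma m.+1%:R)%E); last first.
    by rewrite eGamma1 eGamma_nat lte_add_pinfty ?ltry.
  rewrite /eGamma -ge0_integralD//; [|exact: mI|exact: mI].
  apply: ge0_le_integral => //.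
    exact: mI.
    by apply: emeasurable_funD; exact: mI.
  move=> t /=; rewrite in_itv/= andbT => t0.
  rewrite /integrand -EFinD lee_fin -mulrDl ler_wpM2r ?expR_ge0//.
  rewrite subrr powRr0 -[m.+1]addn1 natrD addrK.
  have [t1|/ltW t1] := leP t 1.
    apply: (@le_trans _ _ 1); last by rewrite lerDl powR_ge0.
    by rewrite -[leRHS](powRr0 t) ger_powR ?t0// subr_ge0.
  apply: (@le_trans _ _ (t `^ m%:R)); last by rewrite lerDr.
  exact: ler_powR.
move=> x0; rewrite ge0_fin_numE//.
have : (eGamma (x + 1) < +oo)%E by apply: ge1; rewrite lerDr ltW.
rewrite eGammaS//; case: (eGamma x) (eGamma_ge0 x) => [r _ _|_|] //; first exact: ltry.
by rewrite mulry gtr0_sg// mul1e.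
Qed.

Lemma GammaS x : 0 < x -> Gamma (x + 1) = x * Gamma x.
Proof. by move=> x0; rewrite !GammaE eGammaS// fineM// eGamma_fin. Qed.

Lemma Gamma_nat n : Gamma n.+1%:R = n`!%:R :> R.
Proof. by rewrite GammaE eGamma_nat. Qed.

(** For arguments at least 1 the integrand is bounded below by [exp (- 2)] on [[1, 2]]; the
    functional equation brings every positive argument to this case. *)
Lemma Gamma_gt0 x : 0 < x -> 0 < Gamma x.
Proof.
have ge1 (y : R) : 1 <= y -> 0 < Gamma y.
  move=> y1; have y0 : 0 < y by exact: lt_le_trans y1.
  rewrite GammaE fine_gt0//; apply/andP; split; last first.
    by rewrite -ge0_fin_numE// eGamma_fin.
  apply: (@lt_le_trans _ _ (\int[mu]_(t in `[1%R, 2%R]) (expR (- 2))%:E)%E).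
    rewrite integral_cst//= lebesgue_measure_itv/= lte_fin ltr1n -EFinB -EFinM.
    by rewrite lte_fin mulr_gt0 ?expR_gt0//; lra.
  apply: (@le_trans _ _ (\int[mu]_(t in `[1%R, 2%R]) integrand y t)%E).
    apply: ge0_le_integral => //.
    - exact: measurable_integrand.
    - move=> t /=; rewrite in_itv/= => /andP[t1 t2].
      rewrite lee_fin -[leLHS]mul1r ler_pM ?expR_ge0//; last by rewrite ler_expR lerN2.
      by rewrite -[leLHS](powRr0 t) ler_powR// subr_ge0.
  apply: ge0_subset_integral => //; first exact: measurable_integrand.
  by move=> t /=; rewrite !in_itv/= andbT => /andP[t1 _]; apply: lt_le_trans t1.
move=> x0; rewrite -(pmulr_rgt0 _ x0) -GammaS//.
by apply: ge1; rewrite lerDr ltW.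
Qed.

End GammaFunction.

(** * The case [a = 0]: powers of the logarithmic series and the recurrence of the norm *)

Section LogSeries.
Context {R : realType}.
Implicit Types (n l N : nat) (gamma a p : R).

(* The truncated series of -ln (1 - X); its constant coefficient 0^-1 is 0. *)
Definition log_series N : {poly R} := \poly_(k < N.+1) k%:R^-1.

Lemma coef_log_series_exp_sum n l :
  (log_series n ^+ l)`_n =
  \sum_(m : {ffun 'I_l -> 'I_n.+1} |
          [forall k, (0 < m k)%N] && (\sum_(k < l) m k == n)%N)
     \prod_(k < l) (m k)%:R^-1.
Proof.
rewrite /log_series poly_def -[X in _ ^+ X]card_ord -prodr_const.
rewrite bigA_distr_bigA coef_sum /= [RHS]big_mkcond; apply: eq_bigr => m _.
rewrite scaler_prod prodrXr coefZ coefXn.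
case: (boolP [forall k, (0 < m k)%N]) => [_|/forallPn[k]] /=.
  by rewrite eq_sym; case: eqP; rewrite ?mulr1 ?mulr0.
(* A tuple with a zero entry contributes nothing, since [0^-1 = 0]: this is the positivity condition
   on tuples. *)
by rewrite -eqn0Ngt => /eqP k0; rewrite (bigD1 k)//= k0 invr0 !mul0r.
Qed.

(** Coefficients up to degree [n] only see terms up to degree [n]. This lets series truncated at [n]
    and at [n.+1] be compared. *)
Lemma coef_log_series_exp_stable N n l : (n <= N)%N ->
  (log_series N ^+ l)`_n = (log_series n ^+ l)`_n.
Proof.
move=> nN.
(* All lower degrees are included because the coefficient of a product involves them. *)
suff : forall i, (i <= n)%N -> (log_series N ^+ l)`_i = (log_series n ^+ l)`_i by exact.
elim: l => [//|l IH] i ilen; rewrite !exprS !coefM; apply: eq_bigr => j _.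
rewrite IH; last by rewrite (leq_trans _ ilen)// leq_subr.
have jn : (j <= n)%N by rewrite (leq_trans _ ilen)// -ltnS.
by rewrite !coef_poly !ltnS jn (leq_trans jn nN).
Qed.

(** The series is divisible by ['X], hence its [l]-th power by ['X^l]. *)
Lemma coef_log_series_exp_small N n l : (n < l)%N -> (log_series N ^+ l)`_n = 0.
Proof.
move=> nl; have -> : log_series N = 'X * \poly_(k < N) k.+1%:R^-1.
  apply/polyP => -[|i]; rewrite coefXM !coef_poly//= ?invr0 ?if_same//.
by rewrite exprMn coefXnM nl.
Qed.

Lemma deriv_log_series N : (1 - 'X) * (log_series N)^`() = 1 - 'X^N.
Proof.
have -> : (log_series N)^`() = \sum_(i < N) 'X^i.
  apply/polyP => i; rewrite coef_deriv coef_poly ltnS coef_sum.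
  have [iN|Ni] := ltnP i N.
    rewrite (bigD1 (Ordinal iN))//= coefXn eqxx big1 ?addr0.
      by rewrite -[LHS]mulr_natr mulVf// pnatr_eq0.
    by move=> j ji; rewrite coefXn eq_sym (negbTE ji : (val j == i) = false).
  by rewrite mul0rn big1// => j _; rewrite coefXn gtn_eqF// (leq_trans (ltn_ord j)).
by apply: oppr_inj; rewrite -mulNr !opprB -subrX1.
Qed.

(** Multiplied by [n! / (l + 1)!], this is the recurrence of the unsigned Stirling numbers of the
    first kind, [S(n+1, l+1) = n S(n, l+1) + S(n, l)]. *)
Lemma coef_log_series_exp_rec n l :
  (log_series n.+1 ^+ l.+1)`_n.+1 *+ n.+1 =
  (log_series n ^+ l.+1)`_n *+ n + (log_series n ^+ l)`_n *+ l.+1.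
Proof.
rewrite -[in RHS](@coef_log_series_exp_stable n.+1 n l.+1)// addrC.
rewrite -(@coef_log_series_exp_stable n.+1 n l)//; apply/eqP; rewrite -subr_eq.
set L := log_series n.+1.
(* The coefficient in degree [n] is compared; the truncation error ['X^(n.+1)] does not reach it. *)
have H : (1 - 'X) * (L ^+ l.+1)^`() = (1 - 'X^(n.+1)) * L ^+ l *+ l.+1.
  by rewrite deriv_exp /= mulrnAr mulrA deriv_log_series.
have := congr1 (fun q : {poly R} => q`_n) H.
rewrite mulrBl mul1r coefB coefXM coefMn mulrBl mul1r coefB coefXnM ltnSn subr0.
rewrite !coef_deriv; case: n {H} @L => [|n] L /= -> //.
Qed.

(** At [a = 0] each factor is [Gamma(m) / m! = 1 / m]. *)
Lemma gen_stirling_log_series n l :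
  gen_stirling 0 n l = n`!%:R / l`!%:R * (log_series n ^+ l)`_n.
Proof.
rewrite coef_log_series_exp_sum /gen_stirling; congr (_ * _).
apply: eq_bigr => m /andP[/forallP m0 _]; apply: eq_bigr => k _.
rewrite subr0 -(prednK (m0 k)) Gamma_nat subr0 (Gamma_nat 0) mulr1.
rewrite factS natrM invfM mulrCA mulfV ?mulr1//.
Qed.

Lemma gCRSF_norm_rec gamma p n :
  gCRSF_norm n.+1 gamma 0 p = (n%:R + gamma) * gCRSF_norm n gamma 0 p.
Proof.
have normE k : gCRSF_norm k gamma 0 p = \sum_(0 <= l < k.+1)
    gamma ^+ l * (k`!%:R / l`!%:R * (log_series k ^+ l)`_k).
  by apply: eq_bigr => l _; rewrite mul0r oppr0 powRr0 mulr1 gen_stirling_log_series.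
rewrite !normE big_nat_recl// expr0 [X in _ * (_ * X)]coefC /= !mulr0 add0r.
(* Index shift: the new top term vanishes because [n < n.+1], and the dropped term [l = 0] vanishes
   through the factor [n] if [n = 0], through the coefficient of 1 otherwise. *)
rewrite mulrDl; have -> : n%:R * (\sum_(0 <= l < n.+1)
      gamma ^+ l * (n`!%:R / l`!%:R * (log_series n ^+ l)`_n)) =
    n%:R * \sum_(0 <= l < n.+1)
      gamma ^+ l.+1 * (n`!%:R / l.+1`!%:R * (log_series n ^+ l.+1)`_n).
  rewrite big_nat_recl// [in RHS]big_nat_recr//=.
  rewrite (coef_log_series_exp_small _ (ltnSn n)) !mulr0 addr0 mulrDr.
  case: n => [|n]; first by rewrite !mul0r addr0.
  by rewrite expr0 [X in _ * (_ * (_ * X))]coefC /= !mulr0 add0r.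
rewrite !mulr_sumr -big_split /=; apply: eq_bigr => l _.
have /eqP := coef_log_series_exp_rec n l.
rewrite -[X in X == _]mulr_natl -[X in _ == X + _]mulr_natl -[X in _ == _ + X]mulr_natl.
move=> /eqP rec.
rewrite factS natrM (mulrC n.+1%:R) -!mulrA [n.+1%:R * (_ * _)]mulrCA rec.
rewrite exprS (factS l) natrM.
have l0 : l`!%:R != 0 :> R by rewrite pnatr_eq0 -lt0n fact_gt0.
field; rewrite l0 /=.
by rewrite -[1 + _](natrD _ 1 l) pnatr_eq0.
Qed.

Lemma gCRSF_R_aux_a0 n gamma p d i j :
  gCRSF_R_aux n gamma 0 p d i = gCRSF_R_aux n gamma 0 p d j.
Proof.
by elim: d i j => [//|d IH] i j /=; rewrite !mul0r (IH i j) (IH i.+1 j.+1).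
Qed.

(** By independence of [j], the recursion reads [R(i) = (i + gamma) R(i + 1)], and [gCRSF_norm_rec]
    supplies the same factor. *)
Lemma gCRSF_R_a0 n gamma p i j : (i <= n)%N ->
  gCRSF_norm n gamma 0 p = gCRSF_norm i gamma 0 p * gCRSF_R n gamma 0 p i j.
Proof.
move=> /subnKC; move: (n - i)%N => d; elim: d i j => [|d IH] i j.
  by rewrite addn0 => <-; rewrite gCRSF_R_last mulr1.
move=> din; have ltin : (i < n)%N by rewrite -din -addSnnS leq_addr.
rewrite (gCRSF_R_rec _ _ _ _ ltin) [gCRSF_R _ _ _ _ _ j.+1](gCRSF_R_aux_a0 _ _ _ _ _ j).
rewrite -/(gCRSF_R _ _ _ _ _ _) (IH i.+1 j) ?addSnnS// gCRSF_norm_rec oppr0 powRr0.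
by ring.
Qed.

End LogSeries.

(** * Positivity of the normalising constant *)

Section Positivity.
Context {R : realType}.
Implicit Types (n l : nat) (gamma a p : R).

Lemma gen_stirling_ge0 a n l : a < 1 -> 0 <= gen_stirling a n l.
Proof.
move=> a1; rewrite /gen_stirling mulr_ge0 ?divr_ge0//.
apply: sumr_ge0 => m /andP[/forallP m0 _]; apply: prodr_ge0 => k _.
have mka : 0 < (m k)%:R - a by rewrite subr_gt0 (lt_le_trans a1)// ler1n.
by rewrite divr_ge0 ?mulr_ge0// ltW// Gamma_gt0// subr_gt0.
Qed.

Lemma gen_stirling_n1_gt0 a n : a < 1 -> (0 < n)%N -> 0 < gen_stirling a n 1.
Proof.
move=> a1 n0; rewrite /gen_stirling mulr_gt0 ?divr_gt0 ?ltr0n ?fact_gt0//.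
have pos (m : nat) : (0 < m)%N -> 0 < m%:R - a.
  by move=> m0; rewrite subr_gt0 (lt_le_trans a1)// ler1n.
(* The 1-tuple with entry [n], a single cluster containing everything. *)
rewrite (bigD1 [ffun=> ord_max])/=; last first.
  rewrite big_ord1 ffunE eqxx andbT; apply/forallP => k; by rewrite ffunE.
rewrite ltr_pwDl//; last first.
  apply: sumr_ge0 => m /andP[/andP[/forallP m0 _] _]; apply: prodr_ge0 => k _.
  by rewrite divr_ge0 ?mulr_ge0// ltW// Gamma_gt0// ?pos// subr_gt0.
rewrite big_ord1 ffunE divr_gt0 ?mulr_gt0 ?Gamma_gt0 ?pos ?subr_gt0//.
Qed.

(** All terms are nonnegative, and the term [l = 1] is positive. *)
Lemma gCRSF_norm_gt0 n gamma a p :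
  a < 1 -> 0 < p -> 0 < gamma -> (0 < n)%N -> 0 < gCRSF_norm n gamma a p.
Proof.
move=> a1 p0 gamma0 n0; rewrite /gCRSF_norm.
rewrite big_ltn// big_ltn// addrCA ltr_pwDl//.
  by apply: mulr_gt0; [rewrite mulr_gt0 ?powR_gt0|exact: gen_stirling_n1_gt0].
have term_ge0 l : 0 <= gamma ^+ l * p `^ (- (a * l%:R)) * gen_stirling a n l.
  apply: mulr_ge0; last exact: gen_stirling_ge0.
  by rewrite mulr_ge0 ?powR_ge0// exprn_ge0// ltW.
by rewrite addr_ge0// sumr_ge0.
Qed.

End Positivity.

(** * Label sequences in order of appearance, extended by one item *)

Section AppearanceOrder.
Local Open Scope nat_scope.
Implicit Types (s : seq nat) (x : nat).

(** The condition at a position involves only earlier labels, so a new last item adds exactly one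
    condition. *)
Lemma appearance_order_rcons s x :
  appearance_order (rcons s x) =
  appearance_order s && ((x \in s) || (x == (num_clusters s).+1)).
Proof.
have ordP t : reflect (forall j, j < size t ->
    (nth 0 t j \in take j t) || (nth 0 t j == (size (undup (take j t))).+1))
    (appearance_order t).
  apply: (iffP forallP) => [H j jt|H j]; first exact: (H (Ordinal jt)).
  exact: H.
apply/ordP/andP => [H|[/ordP H sx] j].
  split.
    apply/ordP => j js; have := H j; rewrite size_rcons ltnW// => /(_ isT).
    by rewrite nth_rcons js -cats1 takel_cat// ltnW.
  have := H (size s); rewrite size_rcons leqnn => /(_ isT).
  by rewrite nth_rcons ltnn eqxx -cats1 take_size_cat.
rewrite size_rcons ltnS leq_eqVlt => /predU1P[->|js].
  by rewrite nth_rcons ltnn eqxx -cats1 take_size_cat.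
rewrite nth_rcons js -cats1 takel_cat; last exact: ltnW.
exact: H.
Qed.

Lemma num_clusters_rcons s x :
  num_clusters (rcons s x) = num_clusters s + (x \notin s).
Proof.
rewrite /num_clusters (perm_size (@perm_undup _ _ (x :: s) _)).
  by rewrite /=; case: (x \in s); rewrite ?addn0 ?addn1.
by move=> y; rewrite mem_rcons.
Qed.

(** Links membership to the range [1..l] of the products over clusters. *)
Lemma mem_appearance_order s : appearance_order s ->
  forall x, (x \in s) = (0 < x <= num_clusters s).
Proof.
elim/last_ind: s => [_ x|s y IH]; first by rewrite in_nil andbC; case: x.
rewrite appearance_order_rcons => /andP[/[dup] sa /IH{}IH ys] x.
rewrite mem_rcons in_cons num_clusters_rcons.
have [yins|yns] /= := boolP (y \in s).
  by rewrite addn0 -IH; case: eqP => // ->.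
move: ys; rewrite (negbTE yns) /= => /eqP ->; rewrite IH addn1.
by rewrite [X in _ = _ && X]leq_eqVlt ltnS; case: eqP => [->|].
Qed.

Lemma cluster_size_rcons s x k :
  cluster_size (rcons s x) k = cluster_size s k + (x == k).
Proof. by rewrite /cluster_size -cats1 count_cat /= addn0. Qed.

Lemma cluster_size_gt0 s k : (0 < cluster_size s k) = (k \in s).
Proof. by rewrite /cluster_size -has_count has_pred1. Qed.

Lemma sum_cluster_size s : appearance_order s ->
  \sum_(1 <= k < (num_clusters s).+1) cluster_size s k = size s.
Proof.
(* Only the bound [m] on labels is kept: a tail of [s] need not be in order of appearance, so
   induction needs the weaker condition. *)
move=> /mem_appearance_order; move: (num_clusters s) => m sm.
have : {in s, forall x, 0 < x <= m} by move=> x; rewrite sm.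
elim: s {sm} => [|y s IH] sm; first by rewrite big1.
rewrite /cluster_size /= big_split /= IH => [|x xs]; last first.
  by apply: sm; rewrite in_cons xs orbT.
have := sm y (mem_head _ _) => ym; rewrite (bigD1_seq y)//= ?iota_uniq//.
  by rewrite eqxx big1// => k; rewrite eq_sym => /negbTE ->.
by rewrite mem_index_iota ltnS.
Qed.

End AppearanceOrder.

(** * The unnormalised weight and the summing out of one label *)

Section Weight.
Context {R : realType}.
Implicit Types (gamma a p : R) (s : seq nat) (n d x j : nat).

Definition gCRSF_weight gamma a p s : R :=
  gamma ^+ num_clusters s * p `^ (- (a * (num_clusters s)%:R)) *
  \prod_(1 <= k < (num_clusters s).+1)
     (Gamma ((cluster_size s k)%:R - a) / Gamma (1 - a)).

Lemma gCRSFE n gamma a p (z : n.-tuple nat) :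
  gCRSF n gamma a p z =
  if appearance_order z then gCRSF_weight gamma a p z / gCRSF_norm n gamma a p
  else 0.
Proof. by rewrite /gCRSF /gCRSF_weight; case: ifP => // _; rewrite mulrAC. Qed.

Lemma gCRSF_weight_rcons_old gamma a p s x : a < 1 -> appearance_order s ->
  x \in s -> gCRSF_weight gamma a p (rcons s x) =
    gCRSF_weight gamma a p s * ((cluster_size s x)%:R - a).
Proof.
move=> a1 sa xs; rewrite /gCRSF_weight num_clusters_rcons xs addn0.
rewrite -[RHS]mulrA; congr (_ * _).
have xI : x \in index_iota 1 (num_clusters s).+1.
  by rewrite mem_index_iota ltnS -mem_appearance_order.
rewrite (bigD1_seq x)//= ?iota_uniq// [in RHS](bigD1_seq x)//= ?iota_uniq//.
(* [GammaS] applies because [x] already occurs: its cluster size is at least 1, which exceeds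
   [a]. *)
rewrite cluster_size_rcons eqxx natrD addrAC GammaS; last first.
  by rewrite subr_gt0 (lt_le_trans a1)// ler1n cluster_size_gt0.
rewrite (eq_bigr (fun k => Gamma ((cluster_size s k)%:R - a) / Gamma (1 - a))).
  by ring.
by move=> k kx; rewrite cluster_size_rcons eq_sym (negbTE kx) addn0.
Qed.

Lemma gCRSF_weight_rcons_new gamma a p s : a < 1 -> 0 < p ->
  appearance_order s ->
  gCRSF_weight gamma a p (rcons s (num_clusters s).+1) =
    gCRSF_weight gamma a p s * (gamma * p `^ (- a)).
Proof.
move=> a1 p0 sa; have xs : (num_clusters s).+1 \notin s.
  by rewrite mem_appearance_order// ltnn.
rewrite /gCRSF_weight num_clusters_rcons xs addn1 big_nat_recr//=.
have -> : cluster_size (rcons s (num_clusters s).+1) (num_clusters s).+1 = 1%N.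
  by rewrite cluster_size_rcons eqxx /cluster_size (count_memPn xs).
(* The new cluster is a singleton, with factor [Gamma (1 - a) / Gamma (1 - a) = 1]. *)
rewrite divff ?mulr1 ?gt_eqF ?Gamma_gt0 ?subr_gt0//.
rewrite (eq_big_nat _ _
  (F2 := fun k => Gamma ((cluster_size s k)%:R - a) / Gamma (1 - a))).
  rewrite -natr1 mulrDr mulr1 opprD powRD ?(lt0r_neq0 p0) ?implybT// exprSr.
  by ring.
by move=> k /andP[_ kl]; rewrite cluster_size_rcons gtn_eqF// addn0.
Qed.

Lemma sum_gCRSF_weight_rcons n gamma a p s d : a < 1 -> 0 < p ->
  appearance_order s -> (size s + d.+1)%N = n ->
  \sum_(0 <= x < (num_clusters s).+2)
    (if appearance_order (rcons s x) then
       gCRSF_weight gamma a p (rcons s x) *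
       gCRSF_R_aux n gamma a p d (num_clusters (rcons s x)) else 0) =
  gCRSF_weight gamma a p s * gCRSF_R_aux n gamma a p d.+1 (num_clusters s).
Proof.
move=> a1 p0 sa sd; have xs : (num_clusters s).+1 \notin s.
  by rewrite mem_appearance_order// ltnn.
(* Label 0 is never admissible; the last label opens a cluster; those in between are in use. *)
rewrite big_ltn// big_nat_recr//= !appearance_order_rcons sa /=.
rewrite [(0%N \in s)]mem_appearance_order//= add0r eqxx orbT.
rewrite gCRSF_weight_rcons_new// num_clusters_rcons xs addn1.
rewrite (eq_big_nat _ _ (F2 := fun k => gCRSF_weight gamma a p s *
  gCRSF_R_aux n gamma a p d (num_clusters s) * ((cluster_size s k)%:R - a))); last first.
  move=> k kl; have ks : k \in s by rewrite mem_appearance_order.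
  rewrite appearance_order_rcons sa ks /= gCRSF_weight_rcons_old//.
  by rewrite num_clusters_rcons ks addn0 mulrAC.
rewrite -mulr_sumr sumrB -natr_sum sum_cluster_size// sumr_const_nat subn1 /=.
(* The recursion, run on [d.+1] remaining items, has the prefix length as its coefficient. *)
have -> : (n - d.+1)%N = size s by rewrite -sd addnK.
by rewrite -mulr_natr; ring.
Qed.

End Weight.

(** * Law of a prefix of the random labels *)

Section Marginal.
Context {R : realType} (d : measure_display) (Omega : measurableType d).
Context (P : probability Omega R) (n : nat) (Z : {RV P >-> n.-tuple nat}).
Implicit Types (s : seq nat) (gamma a p : R).

Definition prefix_event s : set Omega :=
  [set x | take (size s) (Z x) = s :> seq nat].

(** A finite intersection of conditions on single coordinates, which are measurable maps. *)
Lemma measurable_prefix_event s : (size s <= n)%N -> measurable (prefix_event s).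
Proof.
move=> sn.
have -> : prefix_event s =
    \bigcap_(i in `I_(size s)) [set x | nth 0%N (Z x) i = nth 0%N s i].
  apply/seteqP; split => x /= => [xs i /= il|xs].
    by rewrite -[in RHS]xs nth_take.
  have st : size (take (size s) (Z x)) = size s by rewrite size_takel// size_tuple.
  apply: (@eq_from_nth _ 0%N) => // i; rewrite st => il.
  by rewrite nth_take//; exact: xs.
apply: bigcap_measurableType => i /= il.
have iltn := leq_trans il sn.
have -> : [set x | nth 0%N (Z x) i = nth 0%N s i] =
    Z @^-1` ((@tnth n nat ^~ (Ordinal iltn)) @^-1` [set nth 0%N s i]).
  by apply/seteqP; split => x /=; rewrite (tnth_nth 0%N).
rewrite -[X in measurable X]setTI; apply: measurable_funPT => //.
rewrite -[X in measurable X]setTI; exact: measurable_tnth.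
Qed.

Lemma prefix_event_bigcup s : (size s < n)%N ->
  prefix_event s = \bigcup_k prefix_event (rcons s k).
Proof.
move=> sn; have tk x : take (size s).+1 (Z x) =
    rcons (take (size s) (Z x)) (nth 0%N (Z x) (size s)) :> seq nat.
  by rewrite (take_nth 0%N)// size_tuple.
apply/seteqP; split => x /=; rewrite /prefix_event /=.
  by move=> xs; exists (nth 0%N (Z x) (size s)) => //=; rewrite size_rcons tk xs.
by move=> [k _] /=; rewrite size_rcons tk => /eqP; rewrite eqseq_rcons => /andP[/eqP].
Qed.

Lemma trivIset_prefix_event s :
  trivIset setT (fun k => prefix_event (rcons s k)).
Proof.
apply/trivIsetP => i j _ _ ij; apply/seteqP; split => // x [] /=.
rewrite /prefix_event /= !size_rcons => -> /eqP; rewrite eqseq_rcons eqxx /=.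
by rewrite (negbTE ij).
Qed.

(** Induction on the number of missing items, over all sequences [s], so that inadmissible
    extensions are known to have probability 0. *)
Lemma prob_prefix_event a p gamma : a < 1 -> 0 < p ->
  (forall z : n.-tuple nat, P (Z @^-1` [set z]) = (gCRSF n gamma a p z)%:E) ->
  forall s, (size s <= n)%N ->
  P (prefix_event s) =
    (if appearance_order s then gCRSF_weight gamma a p s *
        gCRSF_R n gamma a p (size s) (num_clusters s) / gCRSF_norm n gamma a p
     else 0)%:E.
Proof.
move=> a1 p0 hZ s /subnKC; rewrite /gCRSF_R; move: (n - size s)%N => k.
elim: k s => [|k IH] s sk.
  rewrite addn0 in sk.
  have ss : size s == n by rewrite sk.
  have -> : prefix_event s = Z @^-1` [set Tuple ss].
    apply/seteqP; split => x; rewrite /prefix_event /= sk.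
      by rewrite take_oversize ?size_tuple// => xs; apply/val_inj.
    by move=> ->; rewrite take_oversize ?sk.
  by rewrite hZ gCRSFE /= mulr1.
have sn : (size s < n)%N by rewrite -sk -addSnnS leq_addr.
pose m := (num_clusters s).+2.
pose c : R := gCRSF_norm n gamma a p.
have Pk i : P (prefix_event (rcons s i)) =
    (if appearance_order (rcons s i) then gCRSF_weight gamma a p (rcons s i) *
       gCRSF_R_aux n gamma a p k (num_clusters (rcons s i)) / c else 0)%:E.
  by rewrite IH// size_rcons -sk addSnnS.
rewrite prefix_event_bigcup// measure_semi_bigcup; first last.
- rewrite -prefix_event_bigcup//; apply: measurable_prefix_event; exact: ltnW.
- exact: trivIset_prefix_event.
- by move=> i; apply: measurable_prefix_event; rewrite size_rcons.
(* Labels from [m = l + 2] on are inadmissible, so the countable sum over next labels is finite. *)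
rewrite (nneseries_split 0 m)// add0n [X in (_ + X)%E]eseries0 ?adde0; last first.
  move=> i mi _; rewrite [LHS]Pk; case: ifP => //.
  rewrite appearance_order_rcons => /andP[sa].
  rewrite mem_appearance_order// => /orP[/andP[_ il]|/eqP il]; exfalso.
    by move: mi; rewrite ltnNge (leq_trans il)// leqW.
  by move: mi; rewrite il ltnn.
rewrite (eq_bigr _ (fun i _ => Pk i)).
rewrite sumEFin; congr EFin.
case: ifPn => [sa|/negbTE sa]; last first.
  by rewrite big1// => i _; rewrite appearance_order_rcons sa.
rewrite -(sum_gCRSF_weight_rcons gamma a1 p0 sa sk) mulr_suml.
by apply: eq_bigr => i _; case: ifP => //; rewrite mul0r.
Qed.

End Marginal.

(** * Both closed forms of the marginal, and consistency in [n] at [a = 0] *)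

Theorem mainTheorem6 (R : realType) (a p gamma0 : R) (n : nat)
    (ha : a < 1) (hp : 0 < p < 1) (hgamma0 : 0 < gamma0) (hn : (1 <= n)%N)
    (d : measure_display) (Omega : measurableType d) (P : probability Omega R)
    (Z : {RV P >-> n.-tuple nat})
    (hZ : forall z : n.-tuple nat,
       P (Z @^-1` [set z]) = (gCRSF n gamma0 a p z)%:E)
    (i : nat) (hi : (1 <= i <= n)%N) (w : i.-tuple nat) :
  [/\ P [set x | take i (Z x) = w :> seq nat] =
        (gCRSF i gamma0 a p w *
         (gCRSF_norm i gamma0 a p / gCRSF_norm n gamma0 a p) *
         gCRSF_R n gamma0 a p i (num_clusters w))%:E,
      appearance_order w ->
        P [set x | take i (Z x) = w :> seq nat] =
        (gCRSF_R n gamma0 a p i (num_clusters w) * gamma0 ^+ num_clusters w *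
           p `^ (- (a * (num_clusters w)%:R)) / gCRSF_norm n gamma0 a p *
         \prod_(1 <= k < n.+1 | (0 < cluster_size w k)%N)
            (Gamma ((cluster_size w k)%:R - a) / Gamma (1 - a)))%:E
    & a = 0 ->
        P [set x | take i (Z x) = w :> seq nat] = (gCRSF i gamma0 0 p w)%:E].
Proof.
have /andP[i1 iln] := hi; have /andP[p0 _] := hp.
have Ni : gCRSF_norm i gamma0 a p != 0 by rewrite gt_eqF// gCRSF_norm_gt0.
have Nn : gCRSF_norm n gamma0 a p != 0 by rewrite gt_eqF// gCRSF_norm_gt0.
have Pw : P [set x | take i (Z x) = w :> seq nat] =
    (gCRSF i gamma0 a p w *
     (gCRSF_norm i gamma0 a p / gCRSF_norm n gamma0 a p) *
     gCRSF_R n gamma0 a p i (num_clusters w))%:E.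
  have := prob_prefix_event ha p0 hZ (s := w).
  rewrite /prefix_event size_tuple => /(_ iln) ->; congr EFin.
  rewrite gCRSFE; case: ifP => _; last by rewrite !mul0r.
  by field; rewrite Ni Nn.
split => //.
- move=> wa; rewrite Pw gCRSFE wa; congr EFin.
  (* There are at most [i <= n] clusters, so the labels [1..n] with nonempty cluster are exactly
     [1..l]. *)
  have wn : (num_clusters w <= n)%N.
    by rewrite (leq_trans (size_undup _))// size_tuple.
  have -> : \prod_(1 <= k < n.+1 | (0 < cluster_size w k)%N)
      (Gamma ((cluster_size w k)%:R - a) / Gamma (1 - a)) =
      \prod_(1 <= k < (num_clusters w).+1)
      (Gamma ((cluster_size w k)%:R - a) / Gamma (1 - a)).
    rewrite [RHS](big_nat_widen _ _ n.+1)// big_nat_cond [RHS]big_nat_cond.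
    apply: eq_bigl => k; rewrite cluster_size_gt0 mem_appearance_order// ltnS.
    by case: (0 < k)%N.
  by rewrite /gCRSF_weight; field; rewrite Ni Nn.
(* The correction factor is 1, since [N_i R(i, l) = N_n] at [a = 0]. *)
- move=> a0; rewrite Pw; subst a; congr EFin; rewrite -mulrA -[RHS]mulr1; congr (_ * _).
  by rewrite mulrAC -(gCRSF_R_a0 _ _ _ iln) divff.
Qed.
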